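(* Let $t\in\{-2,-1,0,1,2\}$ and let $\ell>5$ be an integer. Then there exists a connected graph $G$ with an edge $e\in E(G)$ such that $\gamma_g(G)=\ell$ and $\gamma_g(G)-\gamma_g(G-e)=t$. Likewise, there exists a connected graph $G$ with an edge $e\in E(G)$ such that $\gamma_g'(G)=\ell$ and $\gamma_g'(G)-\gamma_g'(G-e)=t$.
   Context: Graphs are finite, simple and undirected. A vertex dominates itself and all its neighbors. The domination game on a graph $G$ is played by two players, Dominator and Staller, who alternately choose a vertex of $G$ such that each chosen vertex dominates at least one vertex that was not dominated by the previously chosen vertices. The game ends when all vertices of $G$ are dominated. Dominator wants the total number of chosen vertices to be as small as possible, Staller wants it to be as large as possible. In Game 1 Dominator moves first; in Game 2 Staller moves first. Assuming both play optimally, $\gamma_g(G)$ (the game domination number) is the total number of vertices chosen in Game 1, and $\gamma_g'(G)$ (the Staller-start game domination number) is the total number of vertices chosen in Game 2. $G-e$ denotes the graph obtained from $G$ by removing the edge $e$ (keeping all vertices). *)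

(* Defs.v *)
From mathcomp Require Import all_boot.

Set Implicit Arguments.
Unset Strict Implicit.
Unset Printing Implicit Defensive.

Record sgraph := SGraph {
  vertex :> finType;
  adj : rel vertex;
  adj_sym : symmetric adj;
  adj_irr : irreflexive adj }.

Definition edges (G : sgraph) : {set {set G}} :=
  [set e : {set G} | [exists x : G, exists y : G, adj x y && (e == [set x; y])]].

Definition connected (G : sgraph) : Prop :=
  0 < #|G| /\ forall x y : G, connect (@adj G) x y.

Section DelEdge.
Variables (G : sgraph) (e : {set G}).

Definition del_adj : rel G := fun x y => adj x y && ([set x; y] != e).

Lemma del_adj_sym : symmetric del_adj.
Proof. by move=> x y; rewrite /del_adj adj_sym setUC. Qed.

Lemma del_adj_irr : irreflexive del_adj.
Proof. by move=> x; rewrite /del_adj adj_irr. Qed.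

Definition del_edge : sgraph := SGraph del_adj_sym del_adj_irr.
End DelEdge.

Inductive player := Dominator | Staller.

Section DominationGame.
Variable G : sgraph.
Implicit Types (v : G) (D : {set G}) (p : player) (n : nat).

Definition cl_nbhd v : {set G} := [set w | (w == v) || adj v w].

(* Below, D is the set of vertices dominated by the moves played so far. *)
Definition legal D v : bool := ~~ (cl_nbhd v \subset D).

Definition play D v : {set G} := D :|: cl_nbhd v.

(* Number of moves still to be played under optimal play when p is to move at *)
(* position D. Each move dominates a new vertex, so fuel n >= #|~: D| (hence  *)
(* n = #|G|) reaches the end of the game, and the default #|G| of the minimum *)
(* is never smaller than the values minimised; game_lenT, game_len_Dominator  *)
(* and game_len_Staller below are the resulting minimax equations.            *)
Fixpoint game_len_rec n p D : nat :=
  if n is m.+1 then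
    if D == setT then 0
    else if p is Dominator then
      (\big[minn/#|G|]_(v | legal D v) game_len_rec m Staller (play D v)).+1
    else
      (\max_(v | legal D v) game_len_rec m Dominator (play D v)).+1
  else 0.

Definition game_len p D : nat := game_len_rec #|G| p D.

Definition gamma_g : nat := game_len Dominator set0.
Definition gamma_g' : nat := game_len Staller set0.

Lemma bigminn_leq k (P : pred G) (F : G -> nat) v :
  P v -> \big[minn/k]_(u | P u) F u <= F v.
Proof.
move=> Pv; have := mem_index_enum v; rewrite unlock.
elim: (index_enum G) => //= w s IHs.
rewrite inE => /orP[/eqP<-|/IHs sv]; first by rewrite Pv geq_minl.
by case: ifP => // _; rewrite geq_min sv orbT.
Qed.

Lemma legal_ex D : D != setT -> exists v, legal D v.
Proof.
rewrite -subTset => /subsetPn[v _ vD]; exists v.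
by apply/subsetPn; exists v; rewrite // inE eqxx.
Qed.

Lemma card_play D v : legal D v -> #|~: play D v| < #|~: D|.
Proof.
move=> /subsetPn[w wv wD]; apply/proper_card/properP; split.
  by rewrite setCS subsetUl.
by exists w; rewrite !inE ?wD // negb_or; rewrite inE in wv; rewrite wv andbF.
Qed.

Lemma game_len_rec_fuel n p D :
  #|~: D| <= n -> game_len_rec n p D = game_len p D.
Proof.
have aux m k q E : #|~: E| <= m -> #|~: E| <= k ->
    game_len_rec m q E = game_len_rec k q E.
  have emptyT F : #|~: F| <= 0 -> F = setT.
    by rewrite leqn0 cards_eq0 => /eqP F0; rewrite -[F]setCK F0 setC0.
  elim: m k q E => [|m IH] [|k] q E Em Ek //=; try by
    rewrite [E]emptyT // eqxx.
  case: eqP => // _; case: q; congr _.+1; apply: eq_bigr => v /card_play Ev;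
    by apply: IH; rewrite -ltnS (leq_trans Ev).
by move=> Dn; apply: aux => //; apply: max_card.
Qed.

Lemma game_lenT p : game_len p setT = 0.
Proof. by rewrite /game_len; case: #|G| => //= n; rewrite eqxx. Qed.

Lemma game_lenE p D : D != setT ->
  game_len p D =
    if p is Dominator then
      (\big[minn/#|G|]_(v | legal D v) game_len Staller (play D v)).+1
    else (\max_(v | legal D v) game_len Dominator (play D v)).+1.
Proof.
move=> DnT; rewrite {1}/game_len.
have := max_card (~: D); case En: #|G| => [|n] Dn /=.
  by have [v _] := legal_ex DnT; have := max_card (pred1 v); rewrite card1 En.
have fuel q v : legal D v ->
    game_len_rec n q (play D v) = game_len q (play D v).
  move=> /card_play Dv; apply: game_len_rec_fuel.
  by rewrite -ltnS (leq_trans Dv Dn).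
by rewrite (negPf DnT); case: p; rewrite -?En; congr _.+1;
   apply: eq_bigr => v; apply: fuel.
Qed.

Lemma game_len_bound p D : game_len p D <= #|~: D|.
Proof.
have [n] := ubnP #|~: D|; elim: n p D => // n IH p D; rewrite ltnS => Dn.
have [->|DnT] := eqVneq D setT; first by rewrite game_lenT.
have step q v : legal D v -> game_len q (play D v) < #|~: D|.
  by move=> /card_play Dv; rewrite (leq_ltn_trans _ Dv) ?IH ?(leq_trans Dv).
rewrite game_lenE //; case: p.
  have [v /[dup] vD /(step Staller)] := legal_ex DnT; apply: leq_ltn_trans.
  exact: (bigminn_leq _ (fun u => game_len Staller (play D u))).
have [v vD] := legal_ex DnT.
have [w wD ->] := eq_bigmax_cond (A := legal D)
  (fun u => game_len Dominator (play D u)) (introT card_gt0P (ex_intro _ v vD)).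
exact: step.
Qed.

Lemma game_len_Dominator D : D != setT ->
  (exists2 v, legal D v &
     game_len Dominator D = (game_len Staller (play D v)).+1) /\
  (forall v, legal D v ->
     game_len Dominator D <= (game_len Staller (play D v)).+1).
Proof.
move=> DnT; rewrite game_lenE //.
set F := fun v => game_len Staller (play D v).
have lb v : legal D v -> \big[minn/#|G|]_(u | legal D u) F u <= F v.
  exact: bigminn_leq.
split=> [|v vD]; last by rewrite ltnS lb.
have : \big[minn/#|G|]_(u | legal D u) F u = #|G| \/
    exists2 v, legal D v & \big[minn/#|G|]_(u | legal D u) F u = F v.
  pose K m := m = #|G| \/ exists2 v, legal D v & m = F v.
  apply: (big_ind K) => [|x y Kx Ky|v vD]; [by left| |by right; exists v].
  by rewrite /minn; case: ifP.
case=> [minG|[v vD ->]]; last by exists v.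
have [v vD] := legal_ex DnT; exists v => //; congr _.+1; apply/eqP.
rewrite eqn_leq lb //= minG.
exact: leq_trans (game_len_bound _ _) (max_card _).
Qed.

Lemma game_len_Staller D : D != setT ->
  (exists2 v, legal D v &
     game_len Staller D = (game_len Dominator (play D v)).+1) /\
  (forall v, legal D v ->
     (game_len Dominator (play D v)).+1 <= game_len Staller D).
Proof.
move=> DnT; rewrite game_lenE //; split=> [|v vD]; last first.
  by rewrite ltnS (leq_bigmax_cond (F := fun u => game_len Dominator (play D u))).
have [v vD] := legal_ex DnT.
have [w wD ->] := eq_bigmax_cond (A := legal D)
  (fun u => game_len Dominator (play D u)) (introT card_gt0P (ex_intro _ v vD)).
by exists w.
Qed.
End DominationGame.

(* Main.v *)
(** Let X be a finite graph and add a clique A of hubs: for every x in X a hub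
    adjacent to the closed neighborhood of x, and further hubs adjacent to
    arbitrary subsets of X.  The result is connected, and Dominator may as well
    play hubs only, so that A is dominated at once; hence both game numbers are
    those of the covering game on X whose moves are the closed neighborhoods of
    X and the given subsets.  In this game deleting an edge between a hub and x
    amounts to removing x from one of the subsets.

    Take for X a fixed graph on n vertices and k isolated vertices.  The values
    of all positions are tabulated by the covered part of the fixed graph and
    by the number of isolated vertices left, and the k-th table depends only on
    the preceding one.  So if the table for k = 2 is the table for k = 0 plus
    2, then the lengths of the games grow by 2 whenever k does, and a finite
    computation gives all lengths of one parity. *)
Require Import Defs.
From mathcomp Require Import all_boot all_order all_algebra.
From mathcomp Require Import zify.
Import GRing.Theory.

Set Implicit Arguments.
Unset Strict Implicit.
Unset Printing Implicit Defensive.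

(** * The continuation principle and the elimination of the hubs *)

Section Game.
Variable G : sgraph.
Implicit Types (v w : G) (A D : {set G}) (p : player).

Lemma playS D1 D2 v : D1 \subset D2 -> play D1 v \subset play D2 v.
Proof. exact: setSU. Qed.

Lemma legalS D1 D2 v : D1 \subset D2 -> legal D2 v -> legal D1 v.
Proof. by move=> s12; apply: contra => /subset_trans; apply. Qed.

(** Induction on the number of undominated vertices, by imitation: Dominator copies an optimal move
    for [D1], Staller one for [D2]. *)
Theorem continuation p D1 D2 :
  D1 \subset D2 -> game_len p D2 <= game_len p D1.
Proof.
have [n] := ubnP #|~: D1|; elim: n p D1 D2 => // n IH p D1 D2.
rewrite ltnS => leD1 s12.
have [->|nT2] := eqVneq D2 setT; first by rewrite game_lenT.
have nT1 : D1 != setT.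
  by apply: contraNneq nT2 => D1T; rewrite -subTset -D1T.
have step q v D : legal D1 v -> play D1 v \subset D ->
    game_len q D <= game_len q (play D1 v).
  by move=> /card_play lv sD; apply: IH => //; apply: leq_trans lv leD1.
case: p.
  have [[v lv ->] _] := game_len_Dominator nT1.
  have [_ le2] := game_len_Dominator nT2.
  have [lv2|] := boolP (legal D2 v).
    by apply: leq_trans (le2 v lv2) _; rewrite ltnS step ?playS.
  (* Here [v] adds nothing to [D2], so [play D1 v] lies inside [D2] and any legal move serves. *)
  rewrite negbK => sv2; have [w lw] := legal_ex nT2.
  apply: leq_trans (le2 w lw) _; rewrite ltnS step //.
  by rewrite !subUset; apply/andP; split; apply: subset_trans (subsetUl _ _).
have [[v lv ->] _] := game_len_Staller nT2.
have [_ le1] := game_len_Staller nT1.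
have lv1 := legalS s12 lv.
by apply: leq_trans (le1 v lv1); rewrite ltnS step ?playS.
Qed.

Section Hub.
Variable A : {set G}.
Hypothesis A_cover :
  forall v, exists2 a, a \in A & A :|: cl_nbhd v \subset cl_nbhd a.
Hypothesis A_legal : forall v, legal A v.
Hypothesis A_clique : {in A, forall a, A \subset cl_nbhd a}.
Hypothesis A_large : forall v, v \notin A -> A :|: cl_nbhd v != setT.

(** An optimal move [v] at [D :|: A] is replaced at [D] by a hub that covers both [A] and the closed
    neighborhood of [v]; [continuation] compares the results. *)
Lemma game_len_hub_Dominator D :
  D :|: A != setT -> game_len Dominator D = game_len Dominator (D :|: A).
Proof.
move=> nT; apply/eqP.
rewrite eqn_leq [_ (D :|: A) <= _]continuation ?subsetUl // andbT.
have [[v /subsetPn[w wv wDA] ->] _] := game_len_Dominator nT.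
have [a aA sva] := A_cover v.
have nTD : D != setT.
  by apply: contraNneq nT => ->; rewrite setTU.
have la : legal D a.
  apply/subsetPn; exists w; first by rewrite (subsetP sva) // inE wv orbT.
  by apply: contra wDA; rewrite inE => ->.
have [_ /(_ a la) le] := game_len_Dominator nTD.
by apply: leq_trans le _; rewrite ltnS continuation // /play -setUA setUS.
Qed.

Theorem game_len_hub p : 0 < #|G| -> game_len p (set0 : {set G}) = game_len p A.
Proof.
move=> G_gt0; have [v0 _] := card_gt0P G_gt0.
have nTA : A != setT.
  by apply: contraTneq (A_legal v0) => ->; rewrite /legal subsetT.
case: p; first by rewrite game_len_hub_Dominator set0U.
have nT0 : set0 != [set: G].
  by apply/eqP=> /setP/(_ v0); rewrite !inE.
(* If Staller opens with a hub, [A] is dominated at once by [A_clique]. Otherwise [A_large] leaves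
   something undominated outside [A], and Dominator's reply can be a hub. *)
have key v : game_len Dominator (play set0 v) = game_len Dominator (play A v).
  rewrite /play set0U; have [vA|vA] := boolP (v \in A).
    by rewrite (setUidPr (A_clique vA)).
  by rewrite setUC -game_len_hub_Dominator // setUC A_large.
have [[v lv e0] le0] := game_len_Staller nT0.
have [[w lw eA] leA] := game_len_Staller nTA.
apply/eqP; rewrite eqn_leq {1}e0 key leA ?A_legal //= eA -key le0 //.
by apply: legalS lw; apply: sub0set.
Qed.
End Hub.
End Game.

(** * Binary trees as lookup tables *)

(* A tree of depth n tabulates a function on sequences of n bits. *)
Inductive tree (A : Type) := Leaf of A | Node of tree A & tree A.
Arguments Leaf {A}.
Arguments Node {A}.

Fixpoint tconst (A : Type) n (a : A) : tree A :=
  if n is n'.+1 then Node (tconst n' a) (tconst n' a) else Leaf a.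

Fixpoint tmap (A B : Type) (f : A -> B) t :=
  match t with
  | Leaf a => Leaf (f a)
  | Node t0 t1 => Node (tmap f t0) (tmap f t1)
  end.

Fixpoint teq (A : eqType) (t u : tree A) : bool :=
  match t, u with
  | Leaf a, Leaf b => a == b
  | Node t0 t1, Node u0 u1 => teq t0 u0 && teq t1 u1
  | _, _ => false
  end.

Fixpoint tall (A : Type) (P : pred A) t : bool :=
  match t with Leaf a => P a | Node t0 t1 => tall P t0 && tall P t1 end.

Fixpoint full (A : Type) n (t : tree A) : bool :=
  match n, t with
  | 0, Leaf _ => true
  | n'.+1, Node t0 t1 => full n' t0 && full n' t1
  | _, _ => false
  end.

Fixpoint get (A : Type) (a : A) t (s : seq bool) : A :=
  match t, s with
  | Leaf b, _ => b
  | Node t0 t1, b :: s' => get a (if b then t1 else t0) s'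
  | Node _ _, [::] => a
  end.

Lemma teqP (A : eqType) (t u : tree A) : teq t u -> t = u.
Proof.
elim: t u => [a|t0 IH0 t1 IH1] [b|u0 u1] //= => [/eqP-> //|].
by case/andP=> /IH0-> /IH1->.
Qed.

Lemma full_const A n (a : A) : full n (tconst n a).
Proof. by elim: n => //= n ->. Qed.

Lemma full_map A B (f : A -> B) n t : full n (tmap f t) = full n t.
Proof. by elim: t n => [a|t0 IH0 t1 IH1] [|n] //=; rewrite IH0 IH1. Qed.

Lemma get_const A n (a b : A) s : size s = n -> get b (tconst n a) s = a.
Proof. by elim: n s => [|n IH] [|[] s] //= [/IH]. Qed.

Lemma get_map A B (f : A -> B) a b n t s :
  full n t -> size s = n -> get b (tmap f t) s = f (get a t s).
Proof.
elim: t n s => [u|t0 IH0 t1 IH1] [|n] //= [|c s] //= /andP[f0 f1] [sz].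
by case: c; [apply: (IH1 n)|apply: (IH0 n)].
Qed.

Lemma tmap_comp A B C (f : B -> C) (g : A -> B) t :
  tmap f (tmap g t) = tmap (f \o g) t.
Proof. by elim: t => //= t0 -> t1 ->. Qed.

Lemma eq_tmap A B (f g : A -> B) t : f =1 g -> tmap f t = tmap g t.
Proof. by move=> fg; elim: t => [a|t0 IH0 t1 IH1] /=; rewrite ?fg ?IH0 ?IH1. Qed.

Lemma tall_map A B (f : A -> B) (P : pred B) t :
  tall P (tmap f t) = tall (P \o f) t.
Proof. by elim: t => //= t0 -> t1 ->. Qed.

Lemma tallT A (P : pred A) t : P =1 xpredT -> tall P t.
Proof. by move=> PT; elim: t => [a|t0 IH0 t1 IH1] /=; rewrite ?PT ?IH0. Qed.

(** * Minimax values of a list of options *)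

(* A value (d, s) is the number of moves left when Dominator, resp. Staller, is to move. *)
Definition value := (nat * nat)%type.

(* An option is the value of the position after the move, where the opponent is
   to move: hence the crossed components. *)
Definition best (L : seq value) : value :=
  if L is v :: L' then
    ((foldr (fun u m => minn u.2 m) v.2 L').+1,
     (foldr (fun u m => maxn u.1 m) v.1 L').+1)
  else (0, 0).

Definition shift c (v : value) : value := (c + v.1, c + v.2).

Lemma best_Dominator L : L != [::] ->
  (exists2 v, v \in L & (best L).1 = v.2.+1) /\
  (forall v, v \in L -> (best L).1 <= v.2.+1).
Proof.
case: L => // v L _ /=; split.
  elim: L => [|u L [w wL [IH]]] /=; first by exists v; rewrite ?inE.
  rewrite IH /minn; case: ltnP => _; first by exists u; rewrite ?inE ?eqxx ?orbT.
  by exists w => //; move: wL; rewrite !inE => /orP[]-> //; rewrite !orbT.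
elim: L => [|u L IH] w /=; first by rewrite inE => /eqP->.
rewrite !inE ltnS geq_min => /or3P[/eqP->|/eqP->|wL]; rewrite ?leqnn //.
  by apply/orP; right; apply: IH; rewrite inE eqxx.
by apply/orP; right; apply: IH; rewrite inE wL orbT.
Qed.

Lemma best_Staller L : L != [::] ->
  (exists2 v, v \in L & (best L).2 = v.1.+1) /\
  (forall v, v \in L -> v.1.+1 <= (best L).2).
Proof.
case: L => // v L _ /=; split.
  elim: L => [|u L [w wL [IH]]] /=; first by exists v; rewrite ?inE.
  rewrite IH /maxn; case: ltnP => _; last by exists u; rewrite ?inE ?eqxx ?orbT.
  by exists w => //; move: wL; rewrite !inE => /orP[]-> //; rewrite !orbT.
elim: L => [|u L IH] w /=; first by rewrite inE => /eqP->.
rewrite !inE ltnS leq_max => /or3P[/eqP->|/eqP->|wL]; rewrite ?leqnn //.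
  by apply/orP; right; apply: IH; rewrite inE eqxx.
by apply/orP; right; apply: IH; rewrite inE wL orbT.
Qed.

(** The empty list is excluded because its value is the constant [(0, 0)]: a finished game does not
    get longer. *)
Lemma best_shift c L : L != [::] -> best (map (shift c) L) = shift c (best L).
Proof.
case: L => // v L _; rewrite /= /shift /= !addnS; congr (_.+1, _.+1).
  by elim: L => //= u L ->; rewrite addn_minr.
by elim: L => //= u L ->; rewrite addn_maxr.
Qed.

(** * Solving the covering game for all positions at once *)

Definition bitor (s m : seq bool) := [seq p.1 || p.2 | p <- zip s m].

Arguments bitor : simpl never.

Lemma bitor_cons b c s m : bitor (b :: s) (c :: m) = (b || c) :: bitor s m.
Proof. by []. Qed.

Lemma size_bitor s m : size m = size s -> size (bitor s m) = size s.
Proof. by move=> e; rewrite size_map size1_zip // e. Qed.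

(** One simultaneous traversal records a move at every position: if the move covers the current
    point, both halves of the table read their option from [t1]. *)
Fixpoint push (m : seq bool) (t : tree value) (e : tree (seq value)) :=
  match m, t, e with
  | b :: m', Node t0 t1, Node e0 e1 =>
      Node (push m' (if b then t1 else t0) e0) (push m' t1 e1)
  | _, Leaf v, Leaf L => Leaf (v :: L)
  | _, _, _ => e
  end.

Definition pushes (ms : seq (seq bool)) (t : tree value) (e : tree (seq value)) :=
  foldr (fun m e' => if head false m then push (behead m) t e' else e') e ms.

(* The tree e lists, for each set of covered points, the values of options
   already known.  All moves from a position that covers the first point stay
   among such positions, so these are solved first and then serve as options
   for the positions that do not cover it. *)
Fixpoint solve n (ms : seq (seq bool)) (e : tree (seq value)) : tree value :=
  match n, e with
  | n'.+1, Node e0 e1 =>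
      let t1 := solve n' (map behead ms) e1 in
      Node (solve n' (map behead [seq m <- ms | ~~ head false m])
                  (pushes ms t1 e0)) t1
  | _, Leaf L => Leaf (best L)
  | _, _ => Leaf (0, 0)
  end.

Lemma full_push n m t e : full n e -> full n (push m t e).
Proof.
elim: n m t e => [|n IH] [|b m] [v|t0 t1] [L|e0 e1] //= /andP[f0 f1].
by rewrite !IH.
Qed.

Lemma get_push n m t e s : size m = n -> size s = n -> full n t -> full n e ->
  get [::] (push m t e) s = get (0, 0) t (bitor s m) :: get [::] e s.
Proof.
elim: n m t e s => [|n IH] [|b m] [v|t0 t1] [L|e0 e1] [|c s] //=.
move=> [sm] [ss] /andP[f0 f1] /andP[g0 g1].
by case: c; case: b => //=; rewrite IH.
Qed.

Lemma full_pushes n ms t e : full n e -> full n (pushes ms t e).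
Proof. by move=> fe; elim: ms => //= m ms IH; case: ifP => // _; apply: full_push. Qed.

Lemma get_pushes n ms t e s :
  all (fun m => size m == n.+1) ms -> size s = n -> full n t -> full n e ->
  get [::] (pushes ms t e) s =
    [seq get (0, 0) t (bitor s (behead m)) | m <- ms & head false m]
      ++ get [::] e s.
Proof.
move=> szm ss ft fe; elim: ms szm => //= m ms IH /andP[szm /IH{}IH].
case: ifP => // _.
by rewrite (@get_push n) ?IH ?size_behead ?(eqP szm) //; apply: full_pushes.
Qed.

Lemma full_solve n ms e : full n e -> full n (solve n ms e).
Proof.
elim: n ms e => [|n IH] ms [L|e0 e1] //= /andP[f0 f1].
by rewrite !IH //; apply: full_pushes.
Qed.

(** Induction on the number of points. If the first point is covered, its bit in a move is
    irrelevant; if not, the moves covering it are legal and lead into [t1], and the others stay in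
    [t0]. This split reorders the options, hence [=i]. *)
Lemma get_solve n ms e s : all (fun m => size m == n) ms -> size s = n ->
  full n e ->
  exists2 L, get (0, 0) (solve n ms e) s = best L &
    L =i get [::] e s ++
         [seq get (0, 0) (solve n ms e) (bitor s m) | m <- ms & bitor s m != s].
Proof.
elim: n ms e s => [|n IH] ms [L|e0 e1] [|b s] //= szm.
  move=> _ _; exists L => // v; rewrite (_ : filter _ _ = [::]) ?cats0 //.
  by elim: ms szm => //= -[|b m] ms IH // /IH->.
case=> ss /andP[f0 f1].
set t1 := solve n (map behead ms) e1.
set e0' := pushes ms t1 e0.
set t0 := solve n _ e0'.
have szb : all (fun m => size m == n) (map behead ms).
  rewrite all_map; apply: sub_all szm => m /= /eqP sz.
  by rewrite size_behead sz.
have ft1 : full n t1 by apply: full_solve.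
case: b.
  have [L -> eL] := IH _ _ _ szb ss f1; exists L => // v.
  rewrite eL !mem_cat; congr (_ || _).
  apply/mapP/mapP => -[m]; rewrite mem_filter => /andP[ms_s m_in] ->.
    case/mapP: m_in ms_s => m' m'_in -> ms_s; exists m'.
      rewrite mem_filter m'_in andbT.
      by have := allP szm _ m'_in; case: m' ms_s {m'_in}.
    by have := allP szm _ m'_in; case: m' {ms_s m'_in}.
  have := allP szm _ m_in; case: m m_in ms_s => //= b m m_in ms_s _.
  exists m => //; rewrite mem_filter; apply/andP; split.
    by move: ms_s; rewrite bitor_cons eqseq_cons eqxx.
  by apply/mapP; exists (b :: m).
have fe0 : full n e0' by apply: full_pushes.
have get_e0 := get_pushes szm ss ft1 f0.
have szf : all (fun m => size m == n) (map behead [seq m <- ms | ~~ head false m]).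
  rewrite all_map all_filter; apply: sub_all szm => m /= /eqP sz.
  by rewrite size_behead sz eqxx implybT.
have [L -> eL] := IH _ _ _ szf ss fe0; exists L => // v.
rewrite eL /e0' get_e0 !mem_cat orbAC [RHS]orbC; congr (_ || _).
apply/orP/mapP.
  case=> /mapP[m]; rewrite mem_filter => /andP[ms_s m_in] ->.
    exists m; last by have := allP szm _ m_in; case: m ms_s {m_in} => [|[]].
    rewrite mem_filter m_in andbT.
    by have := allP szm _ m_in; case: m ms_s {m_in} => [|[]].
  case/mapP: m_in ms_s => m'; rewrite mem_filter => /andP[hm m'_in] -> ms_s.
  exists m'; last by have := allP szm _ m'_in; case: m' hm {ms_s m'_in} => [|[]].
  rewrite mem_filter m'_in andbT.
  by have := allP szm _ m'_in; case: m' hm ms_s {m'_in} => [|[]].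
case=> m; rewrite mem_filter => /andP[ms_s m_in] ->.
have := allP szm _ m_in; case: m m_in ms_s => //= -[] m m_in ms_s _.
  left; apply/mapP; exists (true :: m) => //.
  by rewrite mem_filter.
right; apply/mapP; exists m => //; rewrite mem_filter; rewrite ms_s.
by apply/mapP; exists (false :: m) => //; rewrite mem_filter.
Qed.

Lemma tall_pushes ms t (P : pred (seq value)) e :
  (forall v L, P L -> P (v :: L)) -> tall P e -> tall P (pushes ms t e).
Proof.
move=> cP Pe.
have Ppush m u f : tall P f -> tall P (push m u f).
  elim: m u f => [|b m IH] [v|t0 t1] [L|e0 e1] //=; try exact: cP.
  by case/andP=> p0 p1; rewrite !IH.
by elim: ms => //= m ms IH; case: ifP => // _; apply: Ppush.
Qed.

Lemma pushes_shift c ms t e :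
  pushes ms (tmap (shift c) t) (tmap (map (shift c)) e) =
  tmap (map (shift c)) (pushes ms t e).
Proof.
have push_shift m u f : push m (tmap (shift c) u) (tmap (map (shift c)) f) =
    tmap (map (shift c)) (push m u f).
  by elim: m u f => [|[] m IH] [v|t0 t1] [L|e0 e1] //=; rewrite -!IH.
by elim: ms => //= m ms ->; case: ifP.
Qed.

(** Nonempty lists at all leaves allow [best_shift] there, and [pushes] only lengthens the lists. *)
Lemma solve_shift c n ms e : full n e -> tall (fun L => L != [::]) e ->
  solve n ms (tmap (map (shift c)) e) = tmap (shift c) (solve n ms e).
Proof.
elim: n ms e => [|n IH] ms [L|e0 e1] //=; first by move=> _ /best_shift->.
move=> /andP[f0 f1] /andP[p0 p1]; rewrite IH // pushes_shift IH //.
  exact: full_pushes.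
exact: tall_pushes.
Qed.

(** * Tables indexed by the isolated points, and their periodicity *)

(* With k.+1 isolated points left, covering one of them leads to table k. *)
Fixpoint table n ms k : tree value :=
  if k is k'.+1 then solve n ms (tmap (fun v => [:: v]) (table n ms k'))
  else solve n ms (tconst n [::]).

Lemma full_table n ms k : full n (table n ms k).
Proof.
by elim: k => [|k IH]; apply: full_solve; rewrite ?full_const ?full_map.
Qed.

Lemma get_table n ms k s : all (fun m => size m == n) ms -> size s = n ->
  exists2 L, get (0, 0) (table n ms k) s = best L &
    L =i (if k is k'.+1 then [:: get (0, 0) (table n ms k') s] else [::]) ++
         [seq get (0, 0) (table n ms k) (bitor s m) | m <- ms & bitor s m != s].
Proof.
move=> szm ss; case: k => [|k] /=.
  have [L -> eL] := get_solve szm ss (full_const n [::]).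
  by exists L => // v; rewrite eL get_const.
have fk := full_table n ms k.
have [|L -> eL] := get_solve (e := tmap (fun v => [:: v]) (table n ms k)) szm ss.
  by rewrite full_map.
by exists L => // v; rewrite eL (get_map _ (0, 0) _ fk).
Qed.

(** [solve_shift] carries the assumed equality from each table to the next; the known options form
    singletons, so no list is empty. *)
Lemma table_period n ms k j s : size s = n ->
  table n ms 2 = tmap (shift 2) (table n ms 0) ->
  get (0, 0) (table n ms (k + j.*2)) s = shift j.*2 (get (0, 0) (table n ms k) s).
Proof.
move=> ss per2; have per i : table n ms i.+2 = tmap (shift 2) (table n ms i).
  elim: i => // i IH.
  rewrite [in LHS]/table -/(table n ms i.+2) IH tmap_comp.
  rewrite (eq_tmap (g := map (shift 2) \o (fun v => [:: v]))) // -tmap_comp.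
  by rewrite solve_shift ?full_map ?full_table // tall_map tallT.
elim: j => [|j IH]; first by rewrite addn0 /shift -surjective_pairing.
by rewrite doubleS !addnS per (get_map _ (0, 0) _ (full_table n ms _)) // IH.
Qed.

(** * Boards and the hub graphs built on them *)

Definition bits n (s : seq nat) := [seq i \in s | i <- iota 0 n].

(** Symmetrized and without loops, so that any list of pairs gives a simple graph. *)
Definition hadj (H : seq (nat * nat)) i j :=
  (i != j) && (((i, j) \in H) || ((j, i) \in H)).

Definition nbhd n H i := [seq j <- iota 0 n | (j == i) || hadj H i j].

Definition moves n H (S : seq (seq nat)) :=
  [seq bits n (nbhd n H i) | i <- iota 0 n] ++ [seq bits n s | s <- S].

Lemma size_bits n s : size (bits n s) = n.
Proof. by rewrite size_map size_iota. Qed.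

Lemma nth_bits n s (i : 'I_n) : nth false (bits n s) i = ((i : nat) \in s).
Proof. by rewrite (nth_map 0) ?size_iota // nth_iota // add0n. Qed.

Lemma size_moves n H S : all (fun m => size m == n) (moves n H S).
Proof.
rewrite all_cat !all_map; apply/andP; split; apply/allP => ? _ /=;
by rewrite size_bits.
Qed.

Lemma nth_bitor s m i : size m = size s ->
  nth false (bitor s m) i = nth false s i || nth false m i.
Proof.
elim: s m i => [|b s IH] [|c m] [|i] //= [sz]; by rewrite ?nth_nil // IH.
Qed.

Section HubGraph.
Variables n m k : nat.

Definition elt := ('I_n + 'I_k)%type.
(** The left summand holds the hubs, one for each element of X and [m] for the given subsets; the
    right summand is X. *)
Definition vert := ((elt + 'I_m) + elt)%type.

Definition elt_adj (H : seq (nat * nat)) (x y : elt) : bool :=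
  match x, y with inl i, inl j => hadj H i j | _, _ => false end.

Definition hub_nbhd H (S : seq (seq nat)) (a : elt + 'I_m) (y : elt) : bool :=
  match a with
  | inl x => (y == x) || elt_adj H x y
  | inr z => if y is inl i then (i : nat) \in nth [::] S z else false
  end.

Definition hub_adj H S : rel vert := fun u v =>
  match u, v with
  | inl a, inl b => a != b
  | inl a, inr y | inr y, inl a => hub_nbhd H S a y
  | inr x, inr y => elt_adj H x y
  end.

Lemma hadj_sym H : symmetric (hadj H).
Proof. by move=> i j; rewrite /hadj eq_sym orbC. Qed.

Lemma elt_adj_sym H : symmetric (elt_adj H).
Proof. by move=> [i|i] [j|j] //=; apply: hadj_sym. Qed.

Lemma hub_adj_sym H S : symmetric (hub_adj H S).
Proof. by move=> [a|x] [b|y] //=; [rewrite eq_sym|apply: elt_adj_sym]. Qed.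

Lemma hub_adj_irr H S : irreflexive (hub_adj H S).
Proof. by move=> [a|[i|i]] //=; rewrite /hadj eqxx. Qed.

Definition hub_graph H S := SGraph (hub_adj_sym H S) (hub_adj_irr H S).

Lemma hub_graph_connected H S : 0 < n -> connected (hub_graph H S).
Proof.
move=> n_gt0; pose r : hub_graph H S := inl (inl (inl (Ordinal n_gt0))).
split; first by apply/card_gt0P; exists r.
have toh a : connect (@adj (hub_graph H S)) r (inl a).
  have [->|ne] := eqVneq (inl a : hub_graph H S) r; first exact: connect0.
  by apply: connect1; rewrite /= eq_sym; apply: contra ne => /eqP->.
have tor v : connect (@adj (hub_graph H S)) r v.
  case: v => [a|x]; first exact: toh.
  by apply: connect_trans (toh (inl x)) (connect1 _); rewrite /= eqxx.
move=> u v; apply: connect_trans (tor v).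
by rewrite (sym_connect_sym (hub_adj_sym H S)).
Qed.

(** * Game lengths of hub graphs read off the tables *)

Section Value.
Variables (H : seq (nat * nat)) (S : seq (seq nat)) (g : rel vert).
Hypotheses (gs : symmetric g) (gi : irreflexive g) (gE : g =2 hub_adj H S).
Let G := SGraph gs gi.
Implicit Types (v : G) (D : {set G}).
Hypothesis sizeS : size S = m.
Hypothesis nbhd_small : all (fun i => bits n (nbhd n H i) != nseq n true) (iota 0 n).
Hypothesis S_legal : all (has (fun i => i < n)) S.
Hypothesis n_gt0 : 0 < n.

Let A : {set G} := [set v | if v is inl _ then true else false].

(* The part of the closed neighborhood of v that lies outside the hubs. *)
Definition trace (v : G) : seq nat * option 'I_k :=
  match v with
  | inl (inl (inl i)) | inr (inl i) => (nbhd n H i, None)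
  | inl (inr z) => (nth [::] S z, None)
  | inl (inl (inr c)) | inr (inr c) => ([::], Some c)
  end.

Lemma mem_nbhd (i j : 'I_n) : (j : nat) \in nbhd n H i = (j == i) || hadj H i j.
Proof. by rewrite mem_filter mem_iota leq0n ltn_ord !andbT. Qed.

Lemma trace_inl (v : G) (i : 'I_n) :
  (inr (inl i) \in cl_nbhd v) = ((i : nat) \in (trace v).1).
Proof.
by case: v => [[[j|c]|z]|[j|c]]; rewrite inE /= gE /= ?mem_nbhd.
Qed.

Lemma trace_inr (v : G) (c : 'I_k) :
  (inr (inr c) \in cl_nbhd v) = (Some c == (trace v).2).
Proof.
by case: v => [[[j|d]|z]|[j|d]]; rewrite inE /= gE /= ?orbF.
Qed.

Definition base (D : {set G}) : seq bool := [seq inr (inl i) \in D | i <- enum 'I_n].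
Definition isolated (D : {set G}) : nat := #|[set c : 'I_k | inr (inr c) \notin D]|.

Lemma size_base D : size (base D) = n.
Proof. by rewrite size_map size_enum_ord. Qed.

Lemma nth_base D (i : 'I_n) : nth false (base D) i = (inr (inl i) \in D).
Proof. by rewrite (nth_map i) ?size_enum_ord // nth_ord_enum. Qed.

Lemma eq_bits (s t : seq bool) : size s = n -> size t = n ->
  (forall i : 'I_n, nth false s i = nth false t i) -> s = t.
Proof.
move=> ss st e; apply: (@eq_from_nth _ false); first by rewrite st.
by rewrite ss => i i_lt; apply: (e (Ordinal i_lt)).
Qed.

Lemma base_play D v : base (play D v) = bitor (base D) (bits n (trace v).1).
Proof.
apply: eq_bits => [||i]; rewrite ?size_bitor ?size_base ?size_bits //.
by rewrite nth_bitor ?size_base ?size_bits // !nth_base nth_bits inE trace_inl.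
Qed.

Lemma isolated_play_None D v : (trace v).2 = None ->
  isolated (play D v) = isolated D.
Proof.
move=> tv; apply: eq_card => c.
by rewrite 2!in_set in_setU trace_inr tv orbF.
Qed.

Lemma isolated_play_Some D v c : (trace v).2 = Some c ->
  inr (inr c) \notin D -> isolated D = (isolated (play D v)).+1.
Proof.
move=> tv cD; rewrite /isolated (cardsD1 c) inE cD; congr _.+1.
apply: eq_card => d; rewrite in_setD1 2!in_set in_setU trace_inr tv.
by rewrite negb_or andbC.
Qed.

Lemma legal_trace D v : A \subset D ->
  legal D v = (bitor (base D) (bits n (trace v).1) != base D) ||
    (if (trace v).2 is Some c then inr (inr c) \notin D else false).
Proof.
move=> AD; apply/subsetPn/orP => [[[a|[i|c]] wv wD]|[]].
- by case/negP: wD; apply: (subsetP AD); rewrite inE.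
- left; apply: contra wD => /eqP /(congr1 (nth false ^~ i)).
  rewrite nth_bitor ?size_base ?size_bits // nth_base nth_bits -trace_inl wv orbT.
  by move=> <-.
- by right; move: wv; rewrite trace_inr => /eqP <-.
- move=> ne; suff [i vi iD] : exists2 i : 'I_n,
      (i : nat) \in (trace v).1 & inr (inl i) \notin D.
    by exists (inr (inl i)); rewrite ?trace_inl.
  apply/exists_inP; apply: contraR ne; rewrite negb_exists_in => /forall_inP sub.
  apply/eqP/eq_bits => [||i]; rewrite ?size_bitor ?size_base ?size_bits //.
  rewrite nth_bitor ?size_base ?size_bits // nth_base nth_bits orbC.
  by case: (boolP (_ \in (trace v).1)) => // /sub; rewrite negbK => ->.
case tv: (trace v).2 => [c|] // cD.
by exists (inr (inr c)); rewrite ?trace_inr ?tv.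
Qed.

Let ms := moves n H S.

Lemma trace_move (v : G) : (trace v).2 = None -> bits n (trace v).1 \in ms.
Proof.
have inb (i : 'I_n) : bits n (nbhd n H i) \in ms.
  rewrite mem_cat; apply/orP; left; apply/mapP; exists (i : nat) => //.
  by rewrite mem_iota /= ltn_ord.
case: v => [[[j|d]|z]|[j|d]] //= _.
rewrite mem_cat; apply/orP; right; apply/mapP; exists (nth [::] S z) => //.
by rewrite mem_nth // sizeS.
Qed.

Lemma move_trace b : b \in ms ->
  exists2 v : G, (trace v).2 = None & bits n (trace v).1 = b.
Proof.
rewrite mem_cat => /orP[] /mapP[i]; last first.
  move=> /(nthP [::])[z]; rewrite sizeS => z_lt <- ->.
  by exists (inl (inr (Ordinal z_lt))).
rewrite mem_iota add0n /= => i_lt ->.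
by exists (inr (inl (Ordinal i_lt))).
Qed.

Let val (D : {set G}) := get (0, 0) (table n ms (isolated D)) (base D).

Lemma bitor0 (s : seq bool) : size s = n -> bitor s (bits n [::]) = s.
Proof.
move=> ss; apply: eq_bits => [||i] //; rewrite ?size_bitor ?size_bits ?ss //.
by rewrite nth_bitor ?size_bits ?ss // nth_bits orbF.
Qed.

Lemma val_options D : A \subset D -> exists2 L, val D = best L &
  forall x, x \in L <-> exists2 v : G, legal D v & x = val (play D v).
Proof.
move=> AD; have [L eL mL] := get_table (isolated D) (size_moves n H S) (size_base D).
exists L => // x; rewrite mL mem_cat; split; last first.
  case=> v lv ->; move: lv; rewrite legal_trace //.
  case tv: (trace v).2 => [c|].
    have t0 : (trace v).1 = [::].
      by case: v tv => [[[j|d]|z]|[j|d]].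
    rewrite t0 bitor0 ?size_base // eqxx /= => cD.
    rewrite (isolated_play_Some tv cD) /val base_play t0 bitor0 ?size_base //.
    by rewrite inE eqxx.
  rewrite orbF => ne; apply/orP; right; apply/mapP.
  exists (bits n (trace v).1); first by rewrite mem_filter ne trace_move.
  by rewrite /val base_play isolated_play_None.
case/orP=> [|/mapP[b]].
  case ek: (isolated D) => [|k'] //; rewrite inE => /eqP->.
  (* Any isolated point still undominated realizes the option given by the preceding table. *)
  have [c] : exists c, c \in [set c : 'I_k | inr (inr c) \notin D].
    by apply/card_gt0P; rewrite -/(isolated D) ek.
  rewrite inE => cD; exists (inr (inr c)); first by rewrite legal_trace //= cD orbT.
  have := @isolated_play_Some D (inr (inr c)) c erefl cD.
  by rewrite ek /val base_play bitor0 ?size_base // => -[->].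
rewrite mem_filter => /andP[ne /move_trace[v tv bv]] ->.
exists v; first by rewrite legal_trace // bv ne.
by rewrite /val base_play isolated_play_None // bv.
Qed.

(** By [val_options] the tabulated values satisfy the same minimax equations as the game lengths. *)
Lemma game_len_val D : A \subset D ->
  game_len Dominator D = (val D).1 /\ game_len Staller D = (val D).2.
Proof.
have [N] := ubnP #|~: D|; elim: N D => // N IH D; rewrite ltnS => leD AD.
have [L -> mL] := val_options AD.
have IHv v : legal D v -> game_len Dominator (play D v) = (val (play D v)).1 /\
    game_len Staller (play D v) = (val (play D v)).2.
  move=> /card_play lv; apply: IH; first exact: leq_trans lv leD.
  by apply: subset_trans AD _; apply: subsetUl.
have [DT|nT] := eqVneq D setT.
  have -> : L = [::].
    case: L mL => // x L /(_ x)[/(_ (mem_head _ _))[v]].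
    by rewrite /legal DT subsetT.
  by rewrite DT !game_lenT.
have L0 : L != [::].
  have [v lv] := legal_ex nT.
  have: val (play D v) \in L by apply/mL; exists v.
  by case: (L).
have inL v : legal D v -> val (play D v) \in L by move=> lv; apply/mL; exists v.
have [[x /mL[v lv xv] bD] minL] := best_Dominator L0.
have [[y /mL[w lw yw] bS] maxL] := best_Staller L0.
have [[v' lv' eD] leD'] := game_len_Dominator nT.
have [[w' lw' eS] leS'] := game_len_Staller nT.
split; apply/eqP; rewrite eqn_leq.
  rewrite {1}bD {1}xv -(IHv v lv).2 leD' //=.
  by rewrite eD (IHv _ lv').2 minL ?inL.
rewrite {2}bS {1}yw -(IHv w lw).1 leS' // andbT.
by rewrite eS (IHv _ lw').1 maxL ?inL.
Qed.

(** [game_len_hub] moves the start of the game to [A]. Of its hypotheses, [S_legal] makes the subset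
    hubs legal at [A], and [nbhd_small] keeps a move at a board point from finishing the game
    together with [A]. *)
Theorem hub_graph_value p :
  game_len p (set0 : {set G}) =
    let v := get (0, 0) (table n ms k) (nseq n false) in
    if p is Dominator then v.1 else v.2.
Proof.
have baseA : base A = nseq n false.
  apply: eq_bits => [||i]; rewrite ?size_base ?size_nseq //.
  by rewrite nth_base nth_nseq ltn_ord inE.
have isoA : isolated A = k.
  by rewrite -[RHS]card_ord; apply: eq_card => c; rewrite !inE.
have [vD vS] := game_len_val (subxx A).
rewrite -isoA -baseA -/(val A).
have hub : game_len p (set0 : {set G}) = game_len p A.
  apply: game_len_hub; last by apply/card_gt0P; exists (inr (inl (Ordinal n_gt0))).
  - case=> [a|x].
      exists (inl a); rewrite ?inE // subUset subxx andbT.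
      apply/subsetP=> -[b|y]; rewrite !inE //= gE /= => _.
      by have [->|_] := eqVneq b a; rewrite ?eqxx ?orbT.
    exists (inl (inl x)); rewrite ?inE // subUset; apply/andP; split.
      apply/subsetP=> -[b|y]; rewrite !inE //= gE /= => _.
      by have [->|_] := eqVneq b (inl x); rewrite ?eqxx ?orbT.
    apply/subsetP=> -[b|y]; rewrite !inE /= !gE /=.
      move=> _.
      by have [->|_] := eqVneq b (inl x); rewrite ?eqxx ?orbT.
    by case/orP=> [/eqP[->]|->]; rewrite ?eqxx ?orbT.
  - move=> v; rewrite legal_trace //; case tv: (trace v).2 => [c|].
      by rewrite !inE orbT.
    rewrite orbF baseA; apply/eqP => e.
    have sub (i : 'I_n) : ((i : nat) \in (trace v).1) = false.
      have := congr1 (nth false ^~ i) e.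
      rewrite nth_bitor ?size_nseq ?size_bits //.
      by rewrite !nth_nseq ltn_ord nth_bits /=.
    case: v tv sub {e} => [[[j|d]|z]|[j|d]] //= _ sub.
    + by have := sub j; rewrite mem_nbhd eqxx.
    + have /(allP S_legal)/hasP[i iz i_lt] : nth [::] S z \in S.
        by rewrite mem_nth // sizeS.
      by have := sub (Ordinal i_lt); rewrite /= iz.
    + by have := sub j; rewrite mem_nbhd eqxx.
  - move=> [a _|x]; last by rewrite inE.
    apply/subsetP=> -[b|y]; rewrite !inE //= gE /= => _.
    by have [->|_] := eqVneq b a; rewrite ?eqxx ?orbT.
  case=> [a|x]; rewrite inE // => _; suff [i ix] : exists i : 'I_n,
      (i : nat) \notin (trace (inr x)).1.
    apply/eqP => /setP/(_ (inr (inl i))).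
    by rewrite in_setU trace_inl (negPf ix) !inE.
  case: x => [j|c] /=; last by exists (Ordinal n_gt0).
  apply/existsP; apply: contraR (allP nbhd_small j _); last first.
    by rewrite mem_iota ltn_ord.
  rewrite negb_exists => /forallP all_in; apply/eqP.
  apply: eq_bits => [||i]; rewrite ?size_bits ?size_nseq //.
  by rewrite nth_bits nth_nseq ltn_ord; have := all_in i; rewrite negbK.
by rewrite hub; case: (p).
Qed.
End Value.
End HubGraph.

(** * Deleting an edge, and computable certificates *)

Lemma set2_eq (T : finType) (u v a b : T) :
  ([set u; v] == [set a; b]) = ((u == a) && (v == b)) || ((u == b) && (v == a)).
Proof.
apply/eqP/orP => [e|]; last first.
  by case=> /andP[/eqP-> /eqP->] //; rewrite setUC.
move/setP: e => e; move: (e u) (e v) (e a) (e b).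
rewrite !inE !eqxx !(eq_sym a) !(eq_sym b) !orbT /=.
by case: (u == a); case: (u == b); case: (v == a); case: (v == b); auto.
Qed.

Definition del_elt x (E : seq nat) := [seq y <- E | y != x].

Lemma del_edge_hub n m k H E S (x : 'I_n) :
  @del_adj (hub_graph n m.+1 k H (E :: S)) [set inl (inr ord0); inr (inl x)] =2
  @hub_adj n m.+1 k H (del_elt x E :: S).
Proof.
have nthE (z : 'I_m.+1) (y : elt n k) :
    hub_nbhd H (E :: S) (inr z) y && ~~ ((z == ord0) && (y == inl x)) =
    hub_nbhd H (del_elt x E :: S) (inr z) y.
  case: y => [i|c] //=; case: z => -[|z] z_lt /=; rewrite ?andbT //.
  by rewrite mem_filter andbC.
move=> [[a|z]|y] [[b|w]|y']; rewrite /del_adj set2_eq /= ?andbT ?orbF //.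
- by rewrite andbF /= ?andbT.
- by rewrite andbF /= ?andbT.
- exact: nthE.
- by rewrite andbF /= ?andbT.
- by rewrite [X in ~~ X]andbC; apply: nthE.
- by rewrite andbF /= ?andbT.
Qed.

Definition valid n H S :=
  all (fun i => bits n (nbhd n H i) != nseq n true) (iota 0 n) &&
  all (has (fun i => i < n)) S.

(** The tables are chained by [let] so that evaluation solves each one once. The bit [k0] is the
    parity of the number of isolated points. *)
Definition has_values n H S (k0 : bool) (v : value) : bool :=
  let ms := moves n H S in
  let T0 := table n ms 0 in
  let next t := solve n ms (tmap (fun v => [:: v]) t) in
  let T1 := next T0 in
  teq (next T1) (tmap (shift 2) T0) &&
  (get (0, 0) (if k0 then T1 else T0) (nseq n false) == v).

Lemma hub_graph_game_len n m k H S (g : rel (vert n m k)) (gs : symmetric g)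
    (gi : irreflexive g) (k0 : bool) v j p :
  g =2 hub_adj H S -> size S = m -> valid n H S -> 0 < n -> has_values n H S k0 v ->
  k = k0 + j.*2 ->
  game_len p (set0 : {set SGraph gs gi}) = (if p is Dominator then v.1 else v.2) + j.*2.
Proof.
move=> gE sS /andP[nS lS] n0 /andP[/teqP per /eqP e] kE.
rewrite (hub_graph_value gs gi gE sS nS lS n0) /=.
have -> : get (0, 0) (table n (moves n H S) k) (nseq n false) = shift j.*2 v.
  rewrite kE table_period ?size_nseq //.
  by move: e; case: (k0) => <-.
by case: p; rewrite addnC.
Qed.

Definition edge_cert n x H E S k0 v w :=
  [&& x < n, x \in E, valid n H (E :: S), valid n H (del_elt x E :: S),
      has_values n H (E :: S) k0 v & has_values n H (del_elt x E :: S) k0 w].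

Lemma edge_cert_graph p j n x H E S k0 v w : edge_cert n x H E S k0 v w ->
  exists (G : sgraph) (e : {set G}),
    [/\ connected G, e \in edges G,
        game_len p (set0 : {set G}) = (if p is Dominator then v.1 else v.2) + j.*2 &
        game_len p (set0 : {set del_edge e}) =
          (if p is Dominator then w.1 else w.2) + j.*2].
Proof.
case/and5P=> x_lt xE val1 val2 /andP[len1 len2].
have n_gt0 : 0 < n by apply: leq_ltn_trans x_lt.
pose k := k0 + j.*2; pose G := hub_graph n (size S).+1 k H (E :: S).
pose i := Ordinal x_lt; pose u : G := inl (inr ord0); pose y : G := inr (inl i).
exists G, [set u; y]; split.
- exact: hub_graph_connected.
- by rewrite inE; apply/existsP; exists u; apply/existsP; exists y; rewrite eqxx andbT.
- exact: (hub_graph_game_len _ _ _ _ _ val1 _ len1).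
(* The adjacency of [del_edge] agrees with that of a hub graph only pointwise, which is why the
   relation [g] was left general. *)
- exact: (hub_graph_game_len (@del_adj_sym G [set u; y]) (@del_adj_irr G [set u; y])
            p (@del_edge_hub n (size S) k H E S i) erefl val2 n_gt0 len2 (erefl k)).
Qed.

Definition pick (p : player) (v : value) : nat := if p is Dominator then v.1 else v.2.

(** * The explicit boards *)

(* On C4 with the four edges as moves, and on C7 with the closed neighborhoods
   and the Fano lines {i, i+1, i+3} as moves, it is a disadvantage to move
   first: the values are (3, 2) and (4, 3).  The deleted edge decides who has to
   open the game there; the two boards give the two parities of l. *)
Definition C4_edges := [:: (0, 1); (2, 3)].
Definition C4_sets := [:: [:: 1; 2]; [:: 3; 0]].
(* A twin is a copy of the vertex 0, covered by the same moves as 0 apart from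
   the hub of the deleted edge: in the presence of this edge, Staller can use
   that hub as a waiting move which covers nothing but the twin. *)
Definition C4_twin_edges := [:: (0, 1); (0, 4); (1, 4); (2, 3)].
Definition C4_twin_sets := [:: [:: 1; 2]; [:: 3; 0; 4]].
Definition C7_edges := [:: (0, 1); (1, 2); (2, 3); (3, 4); (4, 5); (5, 6); (6, 0)].
Definition Fano_sets := [:: [:: 0; 1; 3]; [:: 1; 2; 4]; [:: 2; 3; 5];
  [:: 3; 4; 6]; [:: 4; 5; 0]; [:: 5; 6; 1]; [:: 6; 0; 2]].
Definition C7_twin_edges := [:: (7, 0); (7, 1); (7, 6)] ++ C7_edges.
Definition Fano_twin_sets := [seq if 0 \in s then 7 :: s else s | s <- Fano_sets].
Definition K4_edges i := [:: (i, i.+1); (i, i.+2); (i, i.+3);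
  (i.+1, i.+2); (i.+1, i.+3); (i.+2, i.+3)].

(** Without the edge, Dominator finishes the K4 and Staller must open the C4 board: 1 + 2 moves.
    With it, Staller answers on the twin and Dominator must open: 1 + 1 + 3. *)
Lemma cert_2_C4 :
  edge_cert 9 4 (C4_twin_edges ++ K4_edges 5) [:: 4; 5]
    ([:: [:: 6]; [:: 7]] ++ C4_twin_sets) false (5, 6) (3, 4).
Proof. by vm_compute. Qed.

Lemma cert_2_C7 :
  edge_cert 12 7 (C7_twin_edges ++ K4_edges 8) [:: 7; 8]
    ([:: [:: 9]; [:: 10]] ++ Fano_twin_sets) false (6, 7) (4, 5).
Proof. by vm_compute. Qed.

(** After either of {0,2} and {1,3}, the set {0,3} still covers one new point, a waiting move for
    Staller. Cut down to {3}, it becomes useless once {1,3} is played. *)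
Lemma cert_1 (k0 : bool) :
  edge_cert 4 0 [:: (0, 2); (1, 3)] [:: 0; 3] [::] k0 (k0 + 3, k0 + 3) (k0 + 2, k0 + 3).
Proof. by case: k0; vm_compute. Qed.

(** Staller can open with the point 4, after which Dominator faces the board of [cert_1]. *)
Lemma cert_1' (k0 : bool) :
  edge_cert 5 0 [:: (0, 2); (1, 3)] [:: 0; 3; 4] [::] k0 (k0 + 3, k0 + 4) (k0 + 3, k0 + 3).
Proof. by case: k0; vm_compute. Qed.

Lemma cert_N1 (k0 : bool) :
  edge_cert 3 2 [:: (0, 1)] [:: 0; 1; 2] [::] k0 (k0 + 1, k0 + 2) (k0 + 2, k0 + 2).
Proof. by case: k0; vm_compute. Qed.

Lemma cert_N1' (k0 : bool) :
  edge_cert 3 2 [:: (1, 2)] [:: 1; 2] [::] k0 (k0 + 2, k0 + 2) (k0 + 2, k0 + 3).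
Proof. by case: k0; vm_compute. Qed.

(** With the edge, Dominator takes 4 and 5 together and Staller opens the C4 board: 1 + 2. Without
    it they cost two moves, and Dominator has to open: 2 + 3. *)
Lemma cert_N2_C4 : edge_cert 6 5 C4_edges [:: 4; 5] C4_sets false (3, 4) (5, 4).
Proof. by vm_compute. Qed.

(** The extra isolated point and the pair {4,5} take two moves, so Staller, moving first, opens the
    C4 board: 2 + 2. The shortened set {4} lets Staller split the pair, and Dominator opens: 3 +
    3. *)
Lemma cert_N2_C4' :
  edge_cert 6 5 ((4, 5) :: C4_edges) [:: 4; 5] C4_sets true (5, 4) (5, 6).
Proof. by vm_compute. Qed.

Lemma cert_N2_C7 : edge_cert 9 8 C7_edges [:: 7; 8] Fano_sets false (4, 5) (6, 5).
Proof. by vm_compute. Qed.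

Lemma cert_N2_C7' :
  edge_cert 9 8 ((7, 8) :: C7_edges) [:: 7; 8] Fano_sets true (6, 5) (6, 7).
Proof. by vm_compute. Qed.

(** * Assembling all differences and lengths *)

Local Open Scope ring_scope.

Definition realizable (p : player) (t : int) (l : nat) :=
  exists (G : sgraph) (e : {set G}),
    [/\ connected G, e \in edges G, game_len p (set0 : {set G}) = l
      & (game_len p (set0 : {set G}))%:Z
          - (game_len p (set0 : {set del_edge e}))%:Z = t].

Lemma realizable_cert p t l n x H E S k0 v w : edge_cert n x H E S k0 v w ->
  (pick p v)%:Z - (pick p w)%:Z = t ->
  (pick p v <= l)%N -> odd l = odd (pick p v) -> realizable p t l.
Proof.
move=> c dt lel oddl.
(* By parity the excess over the certified length is even; it is made up by pairs of isolated
   points. *)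
have el : l = (pick p v + (l - pick p v)./2.*2)%N by lia.
have [G [e [cG eG gG gD]]] := edge_cert_graph p (l - pick p v)./2 c.
exists G, e; split=> //; first by rewrite gG -/(pick p v) -el.
rewrite gG gD; move: dt; rewrite /pick; lia.
Qed.

(** The case t = 0 uses the boards for t = -1 with the other player starting. The bound on [l] comes
    from t = 2, where certified lengths reach 6 and 7. *)
Lemma realizable_all (p : player) (t : int) (l : nat) :
  t \in [:: - 2; - 1; 0; 1; 2] -> (5 < l)%N -> realizable p t l.
Proof.
move=> + l5; rewrite !inE; have [ol|el] := boolP (odd l); case: p;
  case/or4P => [| | |/orP[]] /eqP ->.
- by apply: (realizable_cert cert_N2_C4) => //=; lia.
- by apply: (realizable_cert (cert_N1 false)) => //=; lia.
- by apply: (realizable_cert (cert_N1' true)) => //=; lia.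
- by apply: (realizable_cert (cert_1 false)) => //=; lia.
- by apply: (realizable_cert cert_2_C4) => //=; lia.
- by apply: (realizable_cert cert_N2_C7') => //=; lia.
- by apply: (realizable_cert (cert_N1' true)) => //=; lia.
- by apply: (realizable_cert (cert_N1 true)) => //=; lia.
- by apply: (realizable_cert (cert_1' true)) => //=; lia.
- by apply: (realizable_cert cert_2_C7) => //=; lia.
- by apply: (realizable_cert cert_N2_C7) => //=; lia.
- by apply: (realizable_cert (cert_N1 true)) => //=; lia.
- by apply: (realizable_cert (cert_N1' false)) => //=; lia.
- by apply: (realizable_cert (cert_1 true)) => //=; lia.
- by apply: (realizable_cert cert_2_C7) => //=; lia.
- by apply: (realizable_cert cert_N2_C4') => //=; lia.
- by apply: (realizable_cert (cert_N1' false)) => //=; lia.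
- by apply: (realizable_cert (cert_N1 false)) => //=; lia.
- by apply: (realizable_cert (cert_1' false)) => //=; lia.
- by apply: (realizable_cert cert_2_C4) => //=; lia.
Qed.

Theorem mainTheorem3 (t : int) (l : nat)
    (ht : t \in [:: - 2; - 1; 0; 1; 2]) (hl : (5 < l)%N) :
  (exists (G : sgraph) (e : {set G}),
     [/\ connected G, e \in edges G, gamma_g G = l
       & (gamma_g G)%:Z - (gamma_g (del_edge e))%:Z = t]) /\
  (exists (G : sgraph) (e : {set G}),
     [/\ connected G, e \in edges G, gamma_g' G = l
       & (gamma_g' G)%:Z - (gamma_g' (del_edge e))%:Z = t]).
Proof.
by split; [apply: (realizable_all Dominator)|apply: (realizable_all Staller)].
Qed.
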